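(* Let $m,n\ge 1$ and let $R=(r_1,\dots,r_m)$ and $S=(s_1,\dots,s_n)$ be vectors of nonnegative integers with $r_i\le n$ for all $i$, $s_j\le m$ for all $j$, and $\sum_i r_i=\sum_j s_j$. Then $\mathcal{A}^{0}(R,S)\neq\emptyset$ if and only if all of the following hold: (a) $R$ is palindromic, i.e. $r_i=r_{m+1-i}$ for all $i$; (b) if $m$ is even then every component of $S$ is even, and if $m$ is odd then $r_{\lceil m/2\rceil}\ge o(S)$, where $o(S)$ is the number of odd components of $S$; (c) $\overline{S}\preceq \overline{R}^*$, where $\overline{S}$ is obtained from $S$ by subtracting one from every odd component, and $\overline{R}$ is $R$ if $m$ is even, or $R$ with the component $r_{\lceil m/2\rceil}$ removed if $m$ is odd.
   Context: $\mathcal{A}^{0}(R,S)$ is the set of $m\times n$ matrices $A$ with entries in $\{0,1\}$, with $i$th row sum $r_i$ and $j$th column sum $s_j$ for all $i,j$, that are invariant under the reflection $r_0$ in a horizontal line, i.e. $a_{i,j}=a_{m+1-i,\,j}$ for all $i,j$. For a nonnegative integer vector $R$, $R^*$ denotes the conjugate of (the weakly decreasing rearrangement of) $R$ viewed as an integer partition: its $k$th component is the number of $i$ with $r_i\ge k$. For nonnegative integer vectors $U,V$, $V\preceq U$ ($V$ is majorized by $U$) means that, after rearranging both in weakly decreasing order (and padding with zeros to a common length), $u_1+\dots+u_\ell\ge v_1+\dots+v_\ell$ for all $\ell$, and the total sums of $U$ and $V$ are equal. *)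

(* Defs.v *)
From mathcomp Require Import all_boot all_order all_algebra.

Set Implicit Arguments.
Unset Strict Implicit.
Unset Printing Implicit Defensive.

(* A vector (x_1, ..., x_m) of nonnegative integers is an [m.-tuple nat] (or,
   when its length may vary, a [seq nat]); indices are shifted to start at 0,
   so row i of an m-row matrix is reflected to row [rev_ord i] = m - 1 - i. *)

Definition symA0 (m n : nat) (R : m.-tuple nat) (S : n.-tuple nat) :
    {set 'M[bool]_(m, n)} :=
  [set A : 'M[bool]_(m, n) |
    [&& [forall i : 'I_m, \sum_(j < n) (A i j : nat) == tnth R i],
        [forall j : 'I_n, \sum_(i < m) (A i j : nat) == tnth S j]
      & [forall i : 'I_m, forall j : 'I_n, A i j == A (rev_ord i) j]]].

Definition palindromic (m : nat) (R : m.-tuple nat) : Prop :=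
  forall i : 'I_m, tnth R i = tnth R (rev_ord i).

(* The list stops at the largest part of [R]; the later components are 0. *)
Definition conjugate (R : seq nat) : seq nat :=
  [seq count (fun r => k <= r) R | k <- iota 1 (\max_(r <- R) r)].

(* [V] is majorized by [U]. Since [take l] returns the whole list once [l]
   exceeds its length, padding with zeros is implicit. *)
Definition majorized (V U : seq nat) : Prop :=
  (forall l : nat, sumn (take l (sort geq V)) <= sumn (take l (sort geq U)))
  /\ sumn V = sumn U.

Definition odd_components (S : seq nat) : nat := count odd S.

Definition Sbar (S : seq nat) : seq nat :=
  [seq if odd s then s.-1 else s | s <- S].

(* For m odd, the 1-based index ceil(m/2) is the 0-based index m./2. *)
Definition middle (R : seq nat) : nat := nth 0 R (size R)./2.

Definition Rbar (R : seq nat) : seq nat :=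
  if odd (size R) then take (size R)./2 R ++ drop (size R)./2.+1 R else R.

(* Main.v *)
(* A symmetric matrix is determined by its top m./2 rows T and, for m odd, its
   middle row.  A column sum s_j is twice a column sum of T, plus the middle
   entry, so that entry must be the parity of s_j and T must have column sums
   s_j./2: this is a Gale-Ryser problem whose majorization condition, doubled,
   is (c).  The Gale-Ryser theorem is obtained row by row, each row having its
   ones in the columns with largest remaining sums; majorization is handled as
   the inequalities sum_{j in J} s_j <= sum_i min(r_i, |J|) over all column
   sets J. *)
Require Import Defs.
From mathcomp Require Import all_boot all_order all_algebra.
From mathcomp Require Import zify.

Set Implicit Arguments.
Unset Strict Implicit.
Unset Printing Implicit Defensive.

(** * Concavity of sums of truncated row lengths *)

Lemma sum_minnS (r : seq nat) (l : nat) :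
  \sum_(x <- r) minn x l.+1 = \sum_(x <- r) minn x l + count (ltn l) r.
Proof.
elim: r => [|x r IH]; first by rewrite !big_nil.
by rewrite !big_cons IH /=; case: (ltnP l x) => /= h; lia.
Qed.

Lemma leq_count_ltn (r : seq nat) (k l : nat) :
  k <= l -> count (ltn l) r <= count (ltn k) r.
Proof. by move=> le_kl; apply: sub_count => x /=; apply: leq_ltn_trans. Qed.

(** The increment from [l] to [l.+1] is [count (ltn l) r], nonincreasing in [l], so each of the [k]
    steps gains at most what the first one gains. *)
Lemma sum_minn_upper (r : seq nat) (l k : nat) :
  \sum_(x <- r) minn x (l + k) <=
    \sum_(x <- r) minn x l + k * count (ltn l) r.
Proof.
elim: k => [|k IH]; first by rewrite addn0 leq_addr.
rewrite addnS sum_minnS mulSn.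
by have := leq_count_ltn r (leq_addr k l); lia.
Qed.

(** Each of the [k] steps gains at least what the last one gains, from [(l + k).-1] to [l + k]. *)
Lemma sum_minn_lower (r : seq nat) (l k : nat) :
  \sum_(x <- r) minn x l + k * count (ltn (l + k).-1) r <=
    \sum_(x <- r) minn x (l + k).
Proof.
elim: k => [|k IH]; first by rewrite mul0n !addn0.
rewrite addnS sum_minnS mulSn /=.
by have := leq_count_ltn r (leq_pred (l + k)); nia.
Qed.

Lemma leq_sum_minn (r : seq nat) (k l : nat) :
  k <= l -> \sum_(x <- r) minn x k <= \sum_(x <- r) minn x l.
Proof. by move=> le_kl; apply: leq_sum => x _; lia. Qed.

(** * The Gale-Ryser theorem in terms of column sets *)

Section GaleRyser.

Variable T : finType.

Lemma largest_subset (s : T -> nat) (k : nat) :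
  k <= #|T| ->
  exists2 X : {set T}, #|X| = k &
    forall x y, x \in X -> y \notin X -> s y <= s x.
Proof.
move=> le_kT; set e := sort (relpre s geq) (enum T).
have e_uniq : uniq e by rewrite sort_uniq enum_uniq.
have se : size e = #|T| by rewrite size_sort cardE.
exists [set x in take k e].
  rewrite cardsE (card_uniqP _) ?take_uniq //.
  by rewrite size_take se; case: ltngtP le_kT.
move=> x y; rewrite !inE => xX yX.
have tr : transitive (relpre s geq) by move=> a b c /= ab bc; apply: leq_trans bc ab.
have : sorted (relpre s geq) e by apply: sort_sorted => a b /=; apply: leq_total.
rewrite sorted_pairwise // -(cat_take_drop k e) pairwise_cat => /and3P[/allrelP h _ _].
apply: h => //.
have : y \in e by rewrite mem_sort mem_enum.
by rewrite -{1}(cat_take_drop k e) mem_cat (negPf yX).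
Qed.

(** Inductive step: once [#|J :&: X|] is moved to the left, the bound is the hypothesis for the rows
    [r] and the column sums left after removing a row with support [X]. *)
Lemma greedy_row (s : T -> nat) (r : seq nat) (X : {set T}) :
  (forall x y, x \in X -> y \notin X -> s y <= s x) ->
  (forall J : {set T}, \sum_(j in J) s j <=
     minn #|X| #|J| + \sum_(x <- r) minn x #|J|) ->
  forall J : {set T}, \sum_(j in J) s j <=
     #|J :&: X| + \sum_(x <- r) minn x #|J|.
Proof.
move=> topX cond J.
have cJ := cardsID X J; have cX := cardsID J X; rewrite setIC in cX.
set g := fun l => \sum_(x <- r) minn x l.
(* The threshold [t] separates: [s] is at most [t] on [J :\: X] and at least [t] on [X :\: J]. *)
pose t := \max_(y in J :\: X) s y.
have le_t y : y \in J :\: X -> s y <= t by move=> yJ; exact: leq_bigmax_cond.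
have ge_t x : x \in X :\: J -> t <= s x.
  rewrite inE => /andP[_ xX]; apply/bigmax_leqP => y; rewrite inE => /andP[yX _].
  exact: topX.
have sJ : \sum_(j in J) s j = \sum_(j in J :&: X) s j + \sum_(j in J :\: X) s j.
  exact: big_setID.
have sU : \sum_(j in J :|: X) s j = \sum_(j in J) s j + \sum_(j in X :\: J) s j.
  by rewrite (big_setID J) /= setUK setDUl setDv set0U.
have cU : #|J :|: X| = #|J| + #|X :\: J|.
  by rewrite -(cardsID J) setUK setDUl setDv set0U.
have s1 : \sum_(j in J :\: X) s j <= #|J :\: X| * t.
  by rewrite -sum_nat_const; apply: leq_sum.
have s2 : #|X :\: J| * t <= \sum_(j in X :\: J) s j.
  by rewrite -sum_nat_const; apply: leq_sum.
have cI := cond (J :&: X); have cU' := cond (J :|: X).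
rewrite -/(g _) in cI; rewrite -/(g _) in cU'; rewrite -/(g _).
(* Concavity of g and integrality: either g has slope >= t up to #|J|, and we
   compare J with J :&: X, or slope <= t.-1 from #|J| on, and we compare J
   with J :|: X. *)
have [le_tc|lt_ct] := leqP t (count (ltn #|J|.-1) r).
  have := sum_minn_lower r #|J :&: X| #|J :\: X|; rewrite cJ -/(g _) -/(g _).
  have : #|J :\: X| * t <= #|J :\: X| * count (ltn #|J|.-1) r.
    by rewrite leq_mul2l le_tc orbT.
  by lia.
have := sum_minn_upper r #|J| #|X :\: J|; rewrite -cU -/(g _) -/(g _).
have := leq_count_ltn r (leq_pred #|J|) => le_c.
(* Strictness saves one unit per element of [X :\: J], which lowers [#|X|] to [#|J :&: X|]. *)
have : #|X :\: J| * (count (ltn #|J|) r).+1 <= #|X :\: J| * t.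
  by rewrite leq_mul2l (leq_ltn_trans le_c lt_ct) orbT.
by rewrite mulnS; lia.
Qed.

(** The matrix is encoded as the list [B] of its row supports. *)
Theorem gale_ryser (r : seq nat) (s : T -> nat) :
  all (fun x => x <= #|T|) r -> \sum_j s j = \sum_(x <- r) x ->
  (forall J : {set T}, \sum_(j in J) s j <= \sum_(x <- r) minn x #|J|) ->
  exists2 B : seq {set T}, map (fun X : {set T} => #|X|) B = r &
    forall j, s j = count (fun X : {set T} => j \in X) B.
Proof.
elim: r s => [|x r IH] s.
  move=> _ tot _; exists [::] => // j; apply/eqP.
  by move/eqP: tot; rewrite big_nil sum_nat_eq0 => /forallP /(_ j).
case/andP=> le_xT le_rT; rewrite big_cons => tot cond.
have [X cX topX] := largest_subset s le_xT.
have tot' : \sum_(j in X) s j + \sum_(j in ~: X) s j = x + \sum_(y <- r) y.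
  rewrite -tot [RHS](bigID (mem X)) /=; congr (_ + _).
  by apply: eq_bigl => j; rewrite inE.
(* If [s z = 0], the columns outside [X] vanish too and [X :\ z] carries the whole total, while
   [cond] allows it at least one less. Hence removing the row never truncates a subtraction. *)
have s_gt0 z : z \in X -> 0 < s z.
  move=> zX; rewrite lt0n; apply/negP => /eqP sz0.
  have out0 : \sum_(j in ~: X) s j = 0.
    apply: big1 => j; rewrite inE => jX.
    by have := topX _ _ zX jX; rewrite sz0 leqn0 => /eqP.
  have := cond (X :\ z); rewrite big_cons.
  have : \sum_(y <- r) minn y #|X :\ z| <= \sum_(y <- r) y.
    by apply: leq_sum => y _; apply: geq_minl.
  have := cardsD1 z X; rewrite zX cX => cz.
  have : \sum_(j in X) s j = s z + \sum_(j in X :\ z) s j by exact: big_setD1.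
  by rewrite sz0; lia.
pose s' j := s j - (j \in X).
have ss' j : s j = (j \in X) + s' j.
  by rewrite /s'; have [/s_gt0|_] := boolP (j \in X); lia.
have sum_s (J : {set T}) : \sum_(j in J) s j = #|J :&: X| + \sum_(j in J) s' j.
  rewrite (eq_bigr _ (fun j _ => ss' j)) big_split /=; congr (_ + _).
  rewrite -sum1_card (big_setID X) /= [X in _ + X]big1 ?addn0; last first.
    by move=> j; rewrite inE => /andP[/negPf->].
  by apply: eq_bigr => j; rewrite inE => /andP[_ ->].
have [|||B cB sB] := IH s'.
- by [].
- have := sum_s setT; rewrite setTI cX.
  under eq_bigl do rewrite inE; rewrite tot => /eqP.
  by rewrite eqn_add2l => /eqP->; apply: eq_bigl => j; rewrite inE.
- move=> J; have := greedy_row topX (r := r) _ J; rewrite sum_s leq_add2l; apply.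
  by move=> K; have := cond K; rewrite big_cons cX.
by exists (X :: B) => [|j] /=; rewrite ?cX ?cB ?ss' ?sB.
Qed.

End GaleRyser.

(** * Conjugates and majorization *)

Lemma sum_iota_leq (x k : nat) : \sum_(i <- iota 1 k) (i <= x) = minn x k.
Proof.
elim: k => [|k IH]; first by rewrite big_nil minn0.
by rewrite -[k.+1]addn1 iotaD big_cat /= IH big_cons big_nil; case: leqP => /=; lia.
Qed.

(** Double counting in the Young diagram: a row of length [x] meets the first [l] columns in
    [minn x l] cells. *)
Lemma sumn_take_conjugate (r : seq nat) (l : nat) :
  sumn (take l (conjugate r)) = \sum_(x <- r) minn x l.
Proof.
rewrite -map_take take_iota sumnE big_map.
under eq_bigr do rewrite -sum1_count big_mkcond /=.
rewrite exchange_big /=; apply: eq_big_seq => x xr.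
transitivity (\sum_(k <- iota 1 (minn l (\max_(r0 <- r) r0))) (k <= x : nat)).
  by apply: eq_bigr => k _; case: leq.
rewrite sum_iota_leq.
have : x <= \max_(y <- r) y by exact: (leq_bigmax_seq x xr).
by lia.
Qed.

Lemma sumn_conjugate (r : seq nat) : sumn (conjugate r) = \sum_(x <- r) x.
Proof.
rewrite -(take_size (conjugate r)) sumn_take_conjugate size_map size_iota.
by apply: eq_big_seq => x xr; apply/minn_idPl; apply: (leq_bigmax_seq x xr).
Qed.

Lemma sorted_conjugate (r : seq nat) : sorted geq (conjugate r).
Proof.
rewrite sorted_map; apply: sub_sorted (iota_sorted 1 _) => i j le_ij /=.
by apply: sub_count => x; apply: leq_trans.
Qed.

Lemma sumn_take_cons (x : nat) (s : seq nat) (k : nat) :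
  path geq x s -> sumn (take k s) <= sumn (take k (x :: s)).
Proof.
elim: s x k => [|y s IH] x [|k] //= /andP[le_yx ys].
by apply: leq_add (IH _ _ ys).
Qed.

(** Lets prefixes control arbitrary column sets. Skipping an entry is harmless, since restoring it
    in front of smaller ones never lowers a prefix sum. *)
Lemma sumn_subseq_take (t s : seq nat) :
  sorted geq s -> subseq t s -> sumn t <= sumn (take (size t) s).
Proof.
elim: s t => [|x s IH] [|y t] //= xs.
have ss := path_sorted xs.
case: eqP => [-> /(IH _ ss)|_ /(IH _ ss)/leq_trans]; first by rewrite leq_add2l.
by apply; apply: (sumn_take_cons (size t).+1 xs).
Qed.

Lemma majorized_conjugateP (T : finType) (v : T -> nat) (r : seq nat) :
  majorized [seq v j | j <- enum T] (conjugate r) <->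
  (forall J : {set T}, \sum_(j in J) v j <= \sum_(x <- r) minn x #|J|) /\
  \sum_j v j = \sum_(x <- r) x.
Proof.
rewrite /majorized sumn_conjugate sumnE big_map big_enum /=.
have geq_tr : transitive geq by move=> a b c /= ab bc; apply: leq_trans bc ab.
rewrite (sorted_sort geq_tr (sorted_conjugate r)).
have V_sorted : sorted geq (sort geq [seq v j | j <- enum T]).
  by apply: sort_sorted => a b; apply: leq_total.
(* Sorting the columns instead of their values turns prefixes into column sets. *)
rewrite sort_map in V_sorted *.
set e := sort _ (enum T) in V_sorted *.
have e_perm : perm_eq e (enum T) by rewrite perm_sort.
have e_uniq : uniq e by rewrite (perm_uniq e_perm) enum_uniq.
split=> [] [maj tot]; split=> //.
- move=> J; rewrite -sumn_take_conjugate.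
  have sumF (F : T -> nat) : \sum_(j in J) F j = \sum_(j <- e | j \in J) F j.
    by rewrite (perm_big _ e_perm) big_enum_cond.
  have -> : #|J| = size [seq v j | j <- e & j \in J].
    by rewrite size_map -sum1_size big_filter -sumF sum1_card.
  rewrite sumF -big_filter -(big_map v predT id) -sumnE.
  apply: leq_trans (maj _).
  by apply: sumn_subseq_take => //; apply/map_subseq/filter_subseq.
move=> l; rewrite sumn_take_conjugate -map_take sumnE big_map.
rewrite big_uniq ?take_uniq //=.
(* This set has fewer than [l] columns once [l] exceeds [#|T|]; monotonicity in the cardinal covers
   that case. *)
have := maj [set j in take l e].
under eq_bigl do rewrite inE.
move/leq_trans; apply; apply: leq_sum_minn.
by rewrite cardsE (card_uniqP _) ?take_uniq // size_take; case: ltnP.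
Qed.

(** * Halving palindromic vectors *)

Lemma sum_palindrome (m : nat) (f : nat -> nat) :
  (forall i, i < m -> f (m - i.+1) = f i) ->
  \sum_(0 <= i < m) f i =
    (\sum_(0 <= i < m./2) f i).*2 + (if odd m then f m./2 else 0).
Proof.
(* The lower half starts at [p]; between [m./2] and [p] lies the middle index, if any. *)
move=> fsym; set p := odd m + m./2.
have mE : m./2 + p = m by lia.
have upper : \sum_(p <= i < m) f i = \sum_(0 <= i < m./2) f i.
  rewrite -[X in \sum_(_ <= _ < X) _]mE -[X in \sum_(X <= _ < _) _]add0n.
  rewrite big_addn addnK big_nat_rev; apply: eq_big_nat => i /andP[_ lt_i].
  by rewrite -(fsym i) //=; [congr f; lia | lia].
rewrite (big_cat_nat (n := m./2)) /=; [|lia|lia].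
rewrite (big_cat_nat (m := m./2) (n := p)) /=; [|lia|lia].
rewrite upper /p; case: (odd m); first by rewrite add1n big_nat1; lia.
by rewrite [X in _ + (X + _)]big_geq //; lia.
Qed.

Lemma sum_take_half (r : seq nat) (F : nat -> nat) :
  \sum_(x <- take (size r)./2 r) F x = \sum_(0 <= i < (size r)./2) F (nth 0 r i).
Proof.
rewrite (big_nth 0) size_take.
have -> : (if (size r)./2 < size r then (size r)./2 else size r) = (size r)./2.
  by case: ltnP => //; lia.
by apply: eq_big_nat => i /andP[_ lt_i]; rewrite nth_take.
Qed.

(** Dropping the middle term of a palindromic sum leaves twice the upper half. [F] is arbitrary to
    cover totals and truncations [minn x k] alike. *)
Lemma sum_Rbar (r : seq nat) (F : nat -> nat) :
  (forall i, i < size r -> nth 0 r (size r - i.+1) = nth 0 r i) ->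
  \sum_(x <- Rbar r) F x = (\sum_(x <- take (size r)./2 r) F x).*2.
Proof.
move=> rsym.
have tot : \sum_(x <- r) F x =
    \sum_(x <- Rbar r) F x + (if odd (size r) then F (middle r) else 0).
  rewrite /Rbar /middle; case: ifP => [odd_r|_]; last by rewrite addn0.
  rewrite -{1}(cat_take_drop (size r)./2 r) !big_cat /=.
  rewrite (drop_nth 0) ?big_cons; last by lia.
  by lia.
have := tot; rewrite (big_nth 0) (sum_palindrome (f := fun i => F (nth 0 r i))); last first.
  by move=> i /rsym->.
by rewrite sum_take_half /middle; lia.
Qed.

(** Exposes the factor 2 to be cancelled against the one in [sum_Rbar]. *)
Lemma SbarE (n : nat) (S : n.-tuple nat) :
  Sbar S = [seq (tnth S j)./2.*2 | j <- enum 'I_n].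
Proof.
rewrite /Sbar -{1}(map_tnth_enum S) -map_comp; apply: eq_map => j /=.
by case: ifP; lia.
Qed.

Lemma palindromicP (m : nat) (R : m.-tuple nat) :
  palindromic R <-> forall i, i < m -> nth 0 R (m - i.+1) = nth 0 R i.
Proof.
split=> [Rsym i lt_im|Rsym i]; last by rewrite !(tnth_nth 0) /= Rsym.
by have := Rsym (Ordinal lt_im); rewrite !(tnth_nth 0) /=.
Qed.

(** * Necessity and sufficiency of (a), (b) and (c) *)

Theorem theorem13 (m n : nat) (R : m.-tuple nat) (S : n.-tuple nat)
    (m_ge1 : 1 <= m) (n_ge1 : 1 <= n)
    (R_le : forall i : 'I_m, tnth R i <= n)
    (S_le : forall j : 'I_n, tnth S j <= m)
    (sumRS : \sum_(i < m) tnth R i = \sum_(j < n) tnth S j) :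
  symA0 R S != set0 <->
  [/\ palindromic R,
      (~~ odd m -> forall j : 'I_n, ~~ odd (tnth S j)) /\
      (odd m -> odd_components S <= middle R)
    & majorized (Sbar S) (conjugate (Rbar R))].
Proof.
have oddE : odd_components S = \sum_(j < n) odd (tnth S j).
  rewrite /odd_components -sum1_count big_mkcond big_tuple.
  by apply: eq_bigr => j _; case: odd.
have takeE (F : nat -> nat) :
    \sum_(x <- take m./2 R) F x = \sum_(0 <= i < m./2) F (nth 0 R i).
  by have := sum_take_half R F; rewrite size_tuple.
rewrite SbarE; split.
- case/set0Pn=> A; rewrite inE => /and3P[/forallP rowA /forallP colA /forallP symA].
  have {}symA i j : A (rev_ord i) j = A i j.
    by have /forallP/(_ j)/eqP := symA i.
  have Rsym : palindromic R.
    move=> i; rewrite -(eqP (rowA i)) -(eqP (rowA (rev_ord i))).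
    by apply: eq_bigr => j _; rewrite symA.
  have /palindromicP Rsym' := Rsym.
  (* [inord] requires the number of rows in successor form. *)
  case: m m_ge1 R R_le A rowA colA symA Rsym Rsym' {S_le} sumRS takeE => // m _ R R_le A
    rowA colA symA Rsym Rsym' sumRS takeE.
  pose a i j : nat := A (inord i) j.
  have row_a i : i < m.+1 -> nth 0 R i = \sum_j a i j.
    move=> lt_i; rewrite -[i](@inordK m) // -tnth_nth -(eqP (rowA _)).
    by rewrite /a inord_val.
  have col_a j : tnth S j = (\sum_(0 <= i < m.+1./2) a i j).*2
                   + (if odd m.+1 then a m.+1./2 j else 0).
    rewrite -sum_palindrome => [|i lt_i].
      by rewrite -(eqP (colA j)) big_mkord; apply: eq_bigr => i _; rewrite /a inord_val.
    rewrite /a -symA; congr (nat_of_bool (A _ _)); apply: val_inj => /=.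
    by rewrite !inordK; lia.
  have half_a j : (tnth S j)./2 = \sum_(0 <= i < m.+1./2) a i j.
    by have := leq_b1 (A (inord m.+1./2) j); rewrite col_a -/(a _ _); case: ifP => _; lia.
  (* Mirrored rows cancel modulo 2, leaving the middle entry; this yields (b). *)
  have odd_a j : odd (tnth S j) = (if odd m.+1 then a m.+1./2 j else 0) :> nat.
    rewrite col_a oddD odd_double /=; case: ifP => _ //.
    by rewrite /a; case: (A _ _).
  split=> //.
    split=> [ev j|od].
      by have := odd_a j; rewrite (negPf ev); case: odd.
    rewrite oddE /middle size_tuple row_a; last by lia.
    by apply: leq_sum => j _; rewrite odd_a od.
  have szR := size_tuple R.
  have half_sum (J : {set 'I_n}) : \sum_(j in J) (tnth S j)./2.*2 =
      (\sum_(0 <= i < m.+1./2) \sum_(j in J) a i j).*2.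
    rewrite exchange_big /= -!muln2 big_distrl /=.
    by apply: eq_bigr => j _; rewrite half_a muln2.
  have halfT : \sum_(j < n) (tnth S j)./2.*2 =
      (\sum_(0 <= i < m.+1./2) \sum_j a i j).*2.
    have := half_sum setT.
    under eq_bigl do rewrite inE.
    move=> ->; congr double; apply: eq_bigr => i _.
    by apply: eq_bigl => j; rewrite inE.
  apply/majorized_conjugateP; split=> [J|]; last first.
    rewrite halfT (sum_Rbar (r := R) id) szR // takeE; congr double.
    by apply: eq_big_nat => i /andP[_ lt_i]; rewrite row_a //; lia.
  rewrite (sum_Rbar (r := R) (fun x => minn x #|J|)) szR // takeE half_sum leq_double.
  rewrite big_nat_cond [leqRHS]big_nat_cond.
  apply: leq_sum => i; rewrite andbT => /andP[_ lt_i].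
  (* The ones of row [i] inside [J] number at most the row sum and at most [#|J|]. *)
  rewrite leq_min -sum1_card; apply/andP; split.
    by rewrite row_a; [rewrite [leqRHS](bigID (mem J)) leq_addr | lia].
  by apply: leq_sum => j _; apply: leq_b1.
case=> /palindromicP Rsym [Sev Sod] /majorized_conjugateP.
have szR := size_tuple R.
rewrite (sum_Rbar (r := R) id) szR // => - [maj tot].
have tot' : \sum_(j < n) (tnth S j)./2 = \sum_(x <- take m./2 R) x.
  apply: double_inj; rewrite -tot -!muln2 big_distrl /=.
  by apply: eq_bigr => j _; rewrite muln2.
(* Cancelling the factor 2 in (c) gives the Gale-Ryser inequalities for the upper half. *)
have [||B cB sB] := @gale_ryser 'I_n (take m./2 R) (fun j => (tnth S j)./2) _ tot'.
- rewrite card_ord; apply/allP => x /mem_take /tnthP[i ->]; exact: R_le.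
- move=> J; have := maj J.
  rewrite (sum_Rbar (r := R) (fun x => minn x #|J|)) szR //.
  under eq_bigr do rewrite -muln2.
  by rewrite -big_distrl /= muln2 leq_double.
have szB : size B = m./2.
  rewrite -(size_map (fun X : {set _} => #|X|)) cB size_take szR.
  by case: ltnP => //; lia.
have cardB i : i < m./2 -> #|nth set0 B i| = nth 0 R i.
  by move=> lt_i; rewrite -[RHS](nth_take 0 lt_i) -cB (nth_map set0) ?szB.
(* The upper half comes from [B], the lower half mirrors it, and the middle row, present only for
   [m] odd, holds the parities of [S]. *)
pose a i j := if i < m./2 then j \in nth set0 B i else
              if m - i.+1 < m./2 then j \in nth set0 B (m - i.+1) else odd (tnth S j).
have a_sym i j : i < m -> a (m - i.+1) j = a i j.
  move=> lt_i; rewrite /a; have -> : m - (m - i.+1).+1 = i by lia.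
  case: (ltnP (m - i.+1) m./2); case: (ltnP i m./2) => //; lia.
(* Equality is forced by the totals: the other rows sum to the total of [Sbar S], leaving
   [odd_components S] for the middle one. *)
have mid_R : odd m -> nth 0 R m./2 = odd_components S.
  move=> od.
  have totR : \sum_(i < m) tnth R i = \sum_(0 <= i < m) nth 0 R i.
    by rewrite big_mkord; apply: eq_bigr => i _; rewrite (tnth_nth 0).
  move: sumRS; rewrite totR sum_palindrome // od oddE -(takeE id) -tot.
  have -> : \sum_(j < n) tnth S j =
      \sum_(j < n) (tnth S j)./2.*2 + \sum_(j < n) odd (tnth S j).
    by rewrite -big_split; apply: eq_bigr => j _ /=; lia.
  by move/eqP; rewrite eqn_add2l => /eqP.
apply/set0Pn; exists (\matrix_(i, j) a i j)%R; rewrite inE; apply/and3P; split.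
- apply/forallP => i; apply/eqP; under eq_bigr do rewrite mxE.
  have sumB (X : {set 'I_n}) : \sum_(j < n) (j \in X) = #|X|.
    by rewrite -sum1_card [RHS]big_mkcond; apply: eq_bigr => j _; case: (j \in X).
  rewrite (tnth_nth 0) /a; case: ltnP => h1; first by rewrite sumB cardB.
  have lt_i := ltn_ord i.
  case: ltnP => h2; first by rewrite sumB cardB // Rsym.
  have iE : i = m./2 :> nat by lia.
  by rewrite -oddE iE mid_R //; lia.
- apply/forallP => j; apply/eqP; under eq_bigr do rewrite mxE.
  rewrite -(big_mkord xpredT (fun i => a i j : nat)) sum_palindrome; last first.
    by move=> i lt_i; rewrite a_sym.
  have -> : \sum_(0 <= i < m./2) a i j = (tnth S j)./2.
    rewrite sB -sum1_count [RHS]big_mkcond [RHS](big_nth set0) szB.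
    by apply: eq_big_nat => i /andP[_ lt_i]; rewrite /a lt_i; case: (j \in _).
  (* For [m] even, (b) makes halving exact; for [m] odd, the middle entry restores the parity. *)
  case: ifP => od; last by have := Sev (negbT od) j; lia.
  rewrite /a ltnn; have -> : (m - m./2.+1 < m./2) = false by lia.
  by lia.
by apply/forallP => i; apply/forallP => j; rewrite !mxE a_sym.
Qed.
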